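(* Let $q\in\mathbb{C}\setminus\{0\}$ be not a root of unity, and let $V_q$ be the $q$-analog Virasoro-like algebra. There are no non-trivial transposed Poisson algebra structures on $V_q$; that is, every transposed Poisson structure $\cdot$ on $V_q$ satisfies $x\cdot y=0$ for all $x,y\in V_q$.
   Context: ''Not a root of unity'' means $q^t\neq 1$ for all positive integers $t$. The $q$-analog Virasoro-like algebra $V_q$ is the complex Lie algebra with basis $\{L_{\mathbf m}\mid \mathbf m\in\mathbb{Z}^2\setminus\{\mathbf 0\}\}$ and bracket $[L_{\mathbf m},L_{\mathbf n}]=\lambda(\mathbf m,\mathbf n)L_{\mathbf m+\mathbf n}$ for $\mathbf m=(m_1,m_2),\mathbf n=(n_1,n_2)\in\mathbb{Z}^2\setminus\{\mathbf 0\}$, where $\lambda(\mathbf m,\mathbf n)=q^{m_2n_1}-q^{m_1n_2}$, with the convention $L_{\mathbf 0}=0$. A transposed Poisson structure on a complex Lie algebra $(L,[\cdot,\cdot])$ is a bilinear, commutative and associative multiplication $\cdot$ on $L$ (no unit required) such that $2z\cdot[x,y]=[z\cdot x,y]+[x,z\cdot y]$ for all $x,y,z\in L$. It is trivial if $x\cdot y=0$ for all $x,y\in L$. *)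

(* Defs.v *)
From HB Require Import structures.
From mathcomp Require Import all_boot all_order all_algebra.
From mathcomp Require Import finmap.
From mathcomp Require Import reals complex.
From mathcomp Require Import monalg ring.

Set Implicit Arguments.
Unset Strict Implicit.
Unset Printing Implicit Defensive.

Import GRing.Theory.

Local Open Scope ring_scope.

HB.mixin Record Lmodule_isLieAlgebra (K : fieldType) L of GRing.Lmodule K L := {
  lie : L -> L -> L;
  lie_bilinear : bilinear_for *:%R *:%R lie;
  liexx : forall x, lie x x = 0;
  lie_jacobi : forall x y z,
    lie x (lie y z) + lie y (lie z x) + lie z (lie x y) = 0
}.

#[short(type="lieAlgType")]
HB.structure Definition LieAlgebra (K : fieldType) :=
  {L of GRing.Lmodule K L & Lmodule_isLieAlgebra K L}.

Record transposed_Poisson (K : fieldType) (L : lieAlgType K)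
    (mul : L -> L -> L) : Prop := TransposedPoisson {
  tp_bilinear : bilinear_for *:%R *:%R mul;
  tp_commutative : commutative mul;
  tp_associative : associative mul;
  tp_compatible : forall x y z,
    2 *: mul z (lie x y) = lie (mul z x) y + lie x (mul z y)
}.

Definition trivial_mul (K : fieldType) (L : lieAlgType K)
  (mul : L -> L -> L) : Prop := forall x y, mul x y = 0.

Definition not_root_of_unity (K : fieldType) (q : K) : Prop :=
  forall t : nat, (0 < t)%N -> q ^+ t != 1.

Definition nzZ2 := {m : int * int | m != 0}.
HB.instance Definition _ := SubChoice.on nzZ2.

Section QVirasoro.

Variables (K : fieldType) (q : K).

Local Notation V := {malg K[nzZ2]}.

(* Extended by 0 at the origin, following the convention L_0 = 0. *)
Definition qvL (m : int * int) : V :=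
  if insub m is Some k then << (k : nzZ2) >> else 0.

Definition qv_lambda (m n : int * int) : K :=
  q ^ (m.2 * n.1) - q ^ (m.1 * n.2).

(* The bilinear extension of [L_m, L_n] = lambda(m, n) L_(m+n). *)
Definition qv_bracket (x y : V) : V :=
  \sum_(m <- msupp x) \sum_(n <- msupp y)
    (x@_m * y@_n * qv_lambda (val m) (val n)) *: qvL (val m + val n).

Lemma qvLE (x : V) : x = \sum_(m <- msupp x) x@_m *: qvL (val m).
Proof.
rewrite {1}[x]monalgE; apply: eq_bigr => m _.
rewrite /qvL valK; apply/malgP => k.
by rewrite mcoeffZ !mcoeffU mulrnAr mulr1.
Qed.

Lemma qv_bracketEw (d1 d2 : {fset nzZ2}) (x y : V) :
  (msupp x `<=` d1)%fset -> (msupp y `<=` d2)%fset ->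
  qv_bracket x y = \sum_(m <- d1) \sum_(n <- d2)
    (x@_m * y@_n * qv_lambda (val m) (val n)) *: qvL (val m + val n).
Proof.
move=> s1 s2; rewrite /qv_bracket.
rewrite (big_fset_incl _ s1) /=; last first.
  move=> m _ mx; apply: big1 => n _.
  by rewrite (mcoeff_outdom mx) !mul0r scale0r.
apply: eq_bigr => m _; rewrite (big_fset_incl _ s2) //= => n _ ny.
by rewrite (mcoeff_outdom ny) mulr0 mul0r scale0r.
Qed.

Lemma qv_bracket_bilinear : bilinear_for *:%R *:%R qv_bracket.
Proof.
split=> [y a x1 x2|x a y1 y2] /=.
- pose d := (msupp x1 `|` msupp x2 `|` msupp (a *: x1 + x2))%fset.
  have s1 : (msupp x1 `<=` d)%fset by rewrite /d -fsetUA fsubsetUl.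
  have s2 : (msupp x2 `<=` d)%fset by rewrite /d fsetUAC fsubsetUr.
  have s3 : (msupp (a *: x1 + x2) `<=` d)%fset by rewrite /d fsubsetUr.
  rewrite (qv_bracketEw s1 (fsubset_refl (msupp y))).
  rewrite (qv_bracketEw s2 (fsubset_refl (msupp y))).
  rewrite (qv_bracketEw s3 (fsubset_refl (msupp y))).
  rewrite scaler_sumr -big_split; apply: eq_bigr => m _ /=.
  rewrite scaler_sumr -big_split; apply: eq_bigr => n _ /=.
  by rewrite mcoeffD mcoeffZ !mulrDl scalerDl scalerA !mulrA.
- pose d := (msupp y1 `|` msupp y2 `|` msupp (a *: y1 + y2))%fset.
  have s1 : (msupp y1 `<=` d)%fset by rewrite /d -fsetUA fsubsetUl.
  have s2 : (msupp y2 `<=` d)%fset by rewrite /d fsetUAC fsubsetUr.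
  have s3 : (msupp (a *: y1 + y2) `<=` d)%fset by rewrite /d fsubsetUr.
  rewrite (qv_bracketEw (fsubset_refl (msupp x)) s1).
  rewrite (qv_bracketEw (fsubset_refl (msupp x)) s2).
  rewrite (qv_bracketEw (fsubset_refl (msupp x)) s3).
  rewrite scaler_sumr -big_split; apply: eq_bigr => m _ /=.
  rewrite scaler_sumr -big_split; apply: eq_bigr => n _ /=.
  rewrite mcoeffD mcoeffZ (mulrDr x@_m) mulrDl scalerDl scalerA.
  by rewrite !mulrA (mulrC x@_m a).
Qed.

HB.instance Definition _ :=
  bilinear_isBilinear.Build K V V V *:%R *:%R qv_bracket qv_bracket_bilinear.

Lemma qv_bracketPl a x1 x2 y :
  qv_bracket (a *: x1 + x2) y = a *: qv_bracket x1 y + qv_bracket x2 y.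
Proof. exact: linearPl. Qed.

Lemma qv_bracketPr a x y1 y2 :
  qv_bracket x (a *: y1 + y2) = a *: qv_bracket x y1 + qv_bracket x y2.
Proof. exact: linearPr. Qed.

Lemma qvL0 : qvL 0 = 0.
Proof. by rewrite /qvL insubF // eqxx. Qed.

Lemma qv_bracketL (m n : int * int) :
  qv_bracket (qvL m) (qvL n) = qv_lambda m n *: qvL (m + n).
Proof.
have [->|m0] := eqVneq m 0.
  by rewrite qvL0 linear0l /qv_lambda /= !mul0r subrr scale0r.
have [->|n0] := eqVneq n 0.
  by rewrite qvL0 linear0r /qv_lambda /= !mulr0 subrr scale0r.
rewrite {1 2}/qvL !insubT /qv_bracket !msuppU oner_eq0 !big_seq_fset1.
by rewrite !mcoeffUU !mul1r !SubK.
Qed.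

Lemma qv_linear_ext (f : V -> V) :
  linear f -> (forall m, f (qvL m) = 0) -> forall x, f x = 0.
Proof.
move=> fP fL x; pose g := GRing.isLinear.Build K V V _ f fP.
pose h : {linear V -> V} := HB.pack f g.
rewrite -[f x]/(h x) [x]qvLE linear_sum; apply: big1 => m _.
by rewrite linearZ /= fL scaler0.
Qed.

Lemma qv_bracketC (x y : V) : qv_bracket x y + qv_bracket y x = 0.
Proof.
move: x; apply: qv_linear_ext => [a x1 x2|m].
  by rewrite qv_bracketPl qv_bracketPr scalerDr addrACA.
move: y; apply: qv_linear_ext => [a y1 y2|n].
  by rewrite qv_bracketPl qv_bracketPr scalerDr addrACA.
rewrite !qv_bracketL (addrC n m) -scalerDl /qv_lambda.
by rewrite (mulrC n.2) (mulrC n.1) addrC subrKA subrr scale0r.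
Qed.

Lemma qv_bracketxx (x : V) : qv_bracket x x = 0.
Proof.
rewrite [x]qvLE; elim/big_rec: _ => [|m y _ yy]; first by rewrite linear0l.
rewrite linearDl !linearDr /= yy addr0 -addrA qv_bracketC addr0.
rewrite linearZl_LR linearZr_LR /= qv_bracketL /qv_lambda.
by rewrite (mulrC (val m).1) subrr scale0r !scaler0.
Qed.

Lemma qv_bracket_jacobi (q_neq0 : q != 0) (x y z : V) :
  qv_bracket x (qv_bracket y z) + qv_bracket y (qv_bracket z x)
  + qv_bracket z (qv_bracket x y) = 0.
Proof.
have addrACA3 (A A' B B' C C' : V) :
    A + A' + (B + B') + (C + C') = A + B + C + (A' + B' + C').
  by rewrite (addrACA A) (addrACA (A + B)).
move: x; apply: qv_linear_ext => [a x1 x2|m].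
  by rewrite !(qv_bracketPl, qv_bracketPr) !scalerDr; apply: addrACA3.
move: y; apply: qv_linear_ext => [a y1 y2|n].
  by rewrite !(qv_bracketPl, qv_bracketPr) !scalerDr; apply: addrACA3.
move: z; apply: qv_linear_ext => [a z1 z2|k].
  by rewrite !(qv_bracketPl, qv_bracketPr) !scalerDr; apply: addrACA3.
rewrite !qv_bracketL !linearZr_LR /= !qv_bracketL !scalerA.
rewrite (addrCA n k m) (addrC n m) (addrCA k m n) (addrC k n) (addrCA m n k).
rewrite -!scalerDl /qv_lambda /= !mulrDr !expfzDr //.
rewrite (mulrC k.2 m.1) (mulrC k.1 m.2) (mulrC n.2 m.1) (mulrC n.1 m.2).
rewrite (mulrC k.2 n.1) (mulrC k.1 n.2).
by rewrite [X in X *: _](_ : _ = 0) ?scale0r //; ring.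
Qed.

End QVirasoro.

(* The nonvanishing of q is a parameter of the type because the Jacobi identity
   needs negative powers of q to be genuine inverses. *)
Definition qVirasoro (K : fieldType) (q : K) (q_neq0 : q != 0) : Type :=
  {malg K[nzZ2]}.

HB.instance Definition _ (K : fieldType) (q : K) (q_neq0 : q != 0) :=
  GRing.Lmodule.copy (qVirasoro q_neq0) {malg K[nzZ2]}.

HB.instance Definition _ (K : fieldType) (q : K) (q_neq0 : q != 0) :=
  Lmodule_isLieAlgebra.Build K (qVirasoro q_neq0) (qv_bracket_bilinear q)
    (qv_bracketxx q) (qv_bracket_jacobi q_neq0).

Lemma lie_qvL (K : fieldType) (q : K) (q_neq0 : q != 0) (m n : int * int) :
  lie (qvL K m : qVirasoro q_neq0) (qvL K n) = qv_lambda q m n *: qvL K (m + n).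
Proof. exact: qv_bracketL. Qed.

(* Main.v *)
Require Import Defs.
From HB Require Import structures.
From mathcomp Require Import all_boot all_order all_algebra.
From mathcomp Require Import reals complex.
From mathcomp Require Import finmap monalg ring.

(** The compatibility axiom says that, for each fixed [z], the map
    [f = mul z] satisfies [2 f([x, y]) = [f x, y] + [x, f y]]: it is a
    half-derivation of the Lie algebra.  The heart of the proof is that a
    half-derivation of [V_q] is diagonal in the basis [L_m]
    ([half_derivation_offdiag]).

    Fix a degree [k != 0] and let [a m] be the coefficient of [L_(m + k)] in
    [f L_m].  Comparing coefficients in the identity for [L_m] and [L_n] gives
    [2 lambda(m, n) a(m + n) = lambda(m + k, n) a(m) + lambda(m, n + k) a(n)].
    Because [q] is not a root of unity, [lambda(m, n)] vanishes only when [m]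
    and [n] are collinear.  For [m] not collinear with [k], the choices
    [n = - k] and [n = k] yield, with [u = q ^ (k_1 k_2)],
    [a(m + k) = 2 u a(m)] and
    [3 u a(m) = (q ^ (m_2 k_1) + q ^ (m_1 k_2)) a(k)].
    In the second relation the factor of [a(k)] is multiplied by [u] when [m] is
    replaced by [m + k], so [a(m + k) = u a(m)] as well, and the two relations
    force [a(m) = 0].  A nonzero [m] collinear with [k] is a sum of two vectors
    that are not, and the identity then gives [a(m) = 0] too.

    Hence [L_p * L_m] is a multiple of [L_m], and by commutativity a multiple of
    [L_p]; it is zero when [p != m].  Finally [L_p * L_p = 0], as one sees by
    writing [L_p] as a multiple of a bracket [[L_m, L_n]] with [m, n != p] and
    applying compatibility once more. *)

Set Implicit Arguments.
Unset Strict Implicit.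
Unset Printing Implicit Defensive.

Import GRing.Theory Num.Theory.

Local Open Scope ring_scope.

(** * Collinear vectors of the integer plane *)

Definition collinear (m n : int * int) := m.2 * n.1 == m.1 * n.2.

Lemma collinear0l m : collinear 0 m.
Proof. by rewrite /collinear !mul0r. Qed.

Lemma collinearxx m : collinear m m.
Proof. by rewrite /collinear mulrC. Qed.

Lemma collinearC m n : collinear m n = collinear n m.
Proof. by rewrite /collinear eq_sym (mulrC m.1) (mulrC m.2). Qed.

Lemma collinearNr m n : collinear m (- n) = collinear m n.
Proof. by rewrite /collinear /= !mulrN eqr_opp. Qed.

Lemma collinearDl m n k : collinear n k -> collinear (m + n) k = collinear m k.
Proof.
by rewrite /collinear /= !mulrDl => /eqP ->; rewrite (inj_eq (addIr _)).
Qed.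

Lemma collinearNl m n : collinear (- m) n = collinear m n.
Proof. by rewrite collinearC collinearNr collinearC. Qed.

Lemma collinearBl m n k : collinear m k -> collinear (m - n) k = collinear n k.
Proof. by move=> mk; rewrite addrC collinearDl // collinearNl. Qed.

(** Both coordinates of [m] annihilate the determinant of [n] and [k], and one of
    them is nonzero. *)
Lemma collinear_trans m n k :
  m != 0 -> collinear n m -> collinear m k -> collinear n k.
Proof.
move=> m0; rewrite /collinear -!(subr_eq0 (_ * _)) => /eqP nm /eqP mk.
have e1 : m.1 * (n.2 * k.1 - n.1 * k.2) = 0.
  transitivity (k.1 * (n.2 * m.1 - n.1 * m.2) + n.1 * (m.2 * k.1 - m.1 * k.2)).
    by ring.
  by rewrite nm mk !mulr0 addr0.
have e2 : m.2 * (n.2 * k.1 - n.1 * k.2) = 0.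
  transitivity (k.2 * (n.2 * m.1 - n.1 * m.2) + n.2 * (m.2 * k.1 - m.1 * k.2)).
    by ring.
  by rewrite nm mk !mulr0 addr0.
move: m0; rewrite -pair_eqE /= negb_and => /orP[] mi0.
  by move/eqP: e1; rewrite mulf_eq0 (negPf mi0).
by move/eqP: e2; rewrite mulf_eq0 (negPf mi0).
Qed.

Lemma exists_noncollinear m : m != 0 -> exists n, ~~ collinear n m.
Proof.
rewrite -pair_eqE /= negb_and /collinear => m0.
have [m1|m1] := eqVneq m.1 0.
  exists (1, 0); rewrite /= !mul0r !mul1r eq_sym.
  by move: m0; rewrite m1 eqxx.
by exists (0, 1); rewrite /= !mul0r !mul1r.
Qed.

(** * The structure constants *)

Lemma exprz_inj_not_root (K : fieldType) (q : K) (q_neq0 : q != 0)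
    (hq : not_root_of_unity q) :
  injective (fun i : int => q ^ i).
Proof.
have exprz_eq1 (n : nat) : q ^ n%:Z = 1 -> n = 0%N.
  by case: n => // n /eqP qn1; have /negP[] := hq n.+1 (ltn0Sn n).
move=> i j /= qij; have : q ^ (i - j) = 1.
  by rewrite expfzDr // -invr_expz qij mulfV // expfz_neq0.
case def_d: (i - j) => [n|n] qd1; apply/eqP; rewrite -subr_eq0 def_d.
  by rewrite (exprz_eq1 _ qd1).
have /exprz_eq1 // : q ^ n.+1%:Z = 1.
by rewrite -[LHS]invrK invr_expz -NegzE qd1 invr1.
Qed.

Section Lambda.

Variables (K : fieldType) (q : K) (q_neq0 : q != 0).
Hypothesis hq : not_root_of_unity q.

Lemma qv_lambda_eq0 m n : (qv_lambda q m n == 0) = collinear m n.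
Proof.
by rewrite /qv_lambda subr_eq0 (inj_eq (exprz_inj_not_root q_neq0 hq)).
Qed.

Lemma qv_lambda0r m : qv_lambda q m 0 = 0.
Proof. by rewrite /qv_lambda /= !mulr0 subrr. Qed.

Lemma qv_lambdaDl m k n : collinear k n ->
  qv_lambda q (m + k) n = q ^ (k.2 * n.1) * qv_lambda q m n.
Proof.
move=> /eqP kn; rewrite /qv_lambda /= !mulrDl !expfzDr // -kn.
by rewrite mulrBr !(mulrC (q ^ (k.2 * n.1))).
Qed.

Lemma qv_lambda_doubler m n :
  qv_lambda q m (n + n) =
    (q ^ (m.2 * n.1) + q ^ (m.1 * n.2)) * qv_lambda q m n.
Proof. by rewrite /qv_lambda /= !mulrDr !expfzDr //; ring. Qed.

(** * The degree-k component of a half-derivation *)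

Section NonzeroDegree.

(* [a m] stands for the coefficient of [L_(m + k)] in the image of [L_m]; the
   convention [L_0 = 0] accounts for [a (- k) = 0] and for the restriction
   [m + n + k != 0]. *)
Variables (k : int * int) (a : int * int -> K).
Hypothesis two_neq0 : (2 : K) != 0.
Hypothesis three_neq0 : (3 : K) != 0.
Hypothesis k_neq0 : k != 0.
Hypothesis aNk : a (- k) = 0.
Hypothesis a_half : forall m n, m + n + k != 0 ->
  2 * qv_lambda q m n * a (m + n) =
    qv_lambda q (m + k) n * a m + qv_lambda q m (n + k) * a n.

(** Translation by [k] multiplies [a] by [2 u] according to the identity with
    [n = - k], and by [u] according to the identity with [n = k]. *)
Lemma noncollinear_coef_eq0 m : ~~ collinear m k -> a m = 0.
Proof.
pose u := q ^ (k.2 * k.1).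
have u_neq0 : u != 0 by rewrite expfz_neq0.
have kk := collinearxx k.
have shift p : ~~ collinear p k -> ~~ collinear (p + k) k.
  by rewrite collinearDl.
have neq0 p : ~~ collinear p k -> p != 0.
  by apply: contraNneq => ->; exact: collinear0l.
have back p : ~~ collinear p k -> a (p + k) = 2 * u * a p.
  (* The identity for [p + k] and [- k]; the term in [a (- k)] carries the
     factor [lambda(p + k, 0) = 0]. *)
  move=> pk; have := @a_half (p + k) (- k).
  rewrite addrK addNr qv_lambda0r mul0r addr0 => /(_ (neq0 _ (shift _ pk))).
  rewrite (@qv_lambdaDl (p + k) k) /=; last by rewrite collinearNr.
  set l := qv_lambda _ _ _ => e.
  have l0 : l != 0 by rewrite qv_lambda_eq0 collinearNr shift.
  apply: (mulfI l0); rewrite mulrN -invr_expz -/u in e.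
  rewrite (_ : _ * (2 * u * _) = u * (2 * l * a p)); last by ring.
  by rewrite e !mulrA mulfV // mul1r.
have forth p : ~~ collinear p k ->
    3 * u * a p = (q ^ (p.2 * k.1) + q ^ (p.1 * k.2)) * a k.
  (* The identity for [p] and [k], with [a (p + k)] eliminated by [back]. *)
  move=> pk; have := @a_half p k (neq0 _ (shift _ (shift _ pk))).
  rewrite back // (@qv_lambdaDl p k k) // qv_lambda_doubler -/u.
  have l0 : qv_lambda q p k != 0 by rewrite qv_lambda_eq0.
  move: (qv_lambda q p k) l0 => l l0 e; apply: (mulfI l0).
  rewrite (_ : l * (3 * u * a p) = 2 * l * (2 * u * a p) - u * l * a p).
    by rewrite e; ring.
  by ring.
move=> mk; have := forth _ (shift _ mk).
rewrite back //= !mulrDl !expfzDr // [k.1 * k.2]mulrC -/u -!mulrDl.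
move=> e; rewrite [RHS]mulrAC -forth // in e.
have : 3 * u * u * a m = 0.
  rewrite (_ : _ * a m = 3 * u * (2 * u * a m) - 3 * u * a m * u); last by ring.
  by rewrite e subrr.
by move/eqP; rewrite !mulf_eq0 (negPf three_neq0) (negPf u_neq0) => /eqP.
Qed.

(** If [m] is collinear with [k] and [n] is not, then neither is [m - n], so
    both terms on the right of the identity for [m - n] and [n] vanish. *)
Lemma coef_eq0 m : m != 0 -> a m = 0.
Proof.
move=> m_neq0; have [mk|] := boolP (collinear m k); last first.
  exact: noncollinear_coef_eq0.
have [m_Nk|mk_neq0] := eqVneq (m + k) 0.
  by rewrite -(addr0_eq (etrans (addrC _ _) m_Nk)).
have [n nk] := exists_noncollinear k_neq0.
have nm : ~~ collinear n m.
  by apply: contraNN nk => /(collinear_trans m_neq0); apply.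
have mnk : ~~ collinear (m - n) k by rewrite collinearBl.
have := @a_half (m - n) n; rewrite subrK => /(_ mk_neq0).
rewrite (noncollinear_coef_eq0 nk) (noncollinear_coef_eq0 mnk) !mulr0 addr0.
move=> /eqP; rewrite !mulf_eq0 (negPf two_neq0) /= qv_lambda_eq0.
rewrite collinearDl ?collinearNl ?collinearxx //.
by rewrite collinearC (negPf nm) => /eqP.
Qed.

End NonzeroDegree.
End Lambda.

(** * Coordinates in the basis L_m *)

Section Coefficients.

Variable K : fieldType.

Local Notation V := {malg K[nzZ2]}.

(** Extended by zero to the origin, so that degrees can be added and subtracted
    freely in [int * int]. *)
Definition qv_coef (p : int * int) (x : V) : K :=
  if insub p is Some k then x@_(k : nzZ2) else 0.

Lemma qv_coef_scalar p : scalar (qv_coef p).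
Proof.
move=> c x y; rewrite /qv_coef; case: insubP => [k _ _|_].
  by rewrite mcoeffD mcoeffZ.
by rewrite mulr0 addr0.
Qed.

HB.instance Definition _ p :=
  GRing.isLinear.Build K V K *%R (qv_coef p) (qv_coef_scalar p).

Lemma qv_coef_at0 x : qv_coef 0 x = 0.
Proof. by rewrite /qv_coef insubF // eqxx. Qed.

Lemma qv_coefL p n : p != 0 -> qv_coef p (qvL K n) = (n == p)%:R.
Proof.
move=> p0; rewrite /qv_coef insubT /qvL; case: insubP => [k _ <-|/negPn/eqP ->].
  by rewrite mcoeffU -val_eqE.
by rewrite mcoeff0 eq_sym (negPf p0).
Qed.

Lemma qv_coef_ext x : (forall p, qv_coef p x = 0) -> x = 0.
Proof.
move=> x0; apply/malgP => k; rewrite mcoeff0.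
by have := x0 (val k); rewrite /qv_coef valK.
Qed.

Lemma qv_coef_bracketr (q : K) p x n : p != 0 ->
  qv_coef p (qv_bracket q x (qvL K n)) =
    qv_coef (p - n) x * qv_lambda q (p - n) n.
Proof.
move=> p0; rewrite [x]qvLE; elim/big_rec: _ => [|m y _ yE].
  by rewrite linear0l !linear0 mul0r.
rewrite qv_bracketPl !linearP /= yE mulrDl -mulrA; congr (_ * _ + _).
rewrite qv_bracketL linearZ /= qv_coefL //.
have [<-|mnp] := eqVneq; first by rewrite addrK qv_coefL ?(valP m) // eqxx mulrC.
have [->|pn0] := eqVneq (p - n) 0; first by rewrite qv_coef_at0 mulr0 mul0r.
by rewrite qv_coefL // eq_sym subr_eq eq_sym (negPf mnp) mulr0 mul0r.
Qed.

Lemma qv_coef_bracketl (q : K) p y m : p != 0 ->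
  qv_coef p (qv_bracket q (qvL K m) y) =
    qv_coef (p - m) y * qv_lambda q m (p - m).
Proof.
move=> p0; have /eqP := qv_bracketC q (qvL K m) y.
rewrite addr_eq0 => /eqP ->; rewrite linearN /= qv_coef_bracketr //.
by rewrite -mulrN /qv_lambda opprB (mulrC m.1) (mulrC m.2).
Qed.

End Coefficients.

(** * Half-derivations and transposed Poisson products *)

Lemma lie0l (K : fieldType) (L : lieAlgType K) (y : L) : lie 0 y = 0.
Proof.
have := lie_bilinear.1 y (-1) 0 0; rewrite /= scaler0 addr0.
  by rewrite scaleN1r addNr.
Qed.

Lemma lie0r (K : fieldType) (L : lieAlgType K) (x : L) : lie x 0 = 0.
Proof.
have := lie_bilinear.2 x (-1) 0 0; rewrite /= scaler0 addr0.
  by rewrite scaleN1r addNr.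
Qed.

Definition half_derivation (K : fieldType) (L : lieAlgType K) (f : L -> L) :=
  forall x y, 2 *: f (lie x y) = lie (f x) y + lie x (f y).

(** Taking coefficients of degree [p + n + k], with [k = r - m], in the
    half-derivation identity for [L_p] and [L_n] isolates the component of
    degree [k], which vanishes by [coef_eq0]. *)
Lemma half_derivation_offdiag (K : fieldType) (q : K) (q_neq0 : q != 0)
    (f : {linear qVirasoro q_neq0 -> qVirasoro q_neq0}) (m r : int * int) :
  not_root_of_unity q -> (2 : K) != 0 -> (3 : K) != 0 ->
  half_derivation f -> r != m -> qv_coef r (f (qvL K m)) = 0.
Proof.
move=> hq two0 three0 f_half rm.
have [->|m0] := eqVneq m 0; first by rewrite qvL0 !linear0.
pose a (p : int * int) := qv_coef (p + (r - m)) (f (qvL K p)).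
suff: a m = 0 by rewrite /a addrC subrK.
apply: (@coef_eq0 _ q q_neq0 hq (r - m) a) => //.
- by rewrite subr_eq0.
- by rewrite /a addNr qv_coef_at0.
move=> p n pnk0; have /(congr1 (qv_coef (p + n + (r - m)))) :=
  f_half (qvL K p) (qvL K n).
rewrite lie_qvL (linearZZ f) !linearZ linearD /=.
rewrite qv_coef_bracketr // qv_coef_bracketl // mulrA => ->.
have -> : p + n + (r - m) - n = p + (r - m) by rewrite addrAC addrK.
have -> : p + n + (r - m) - p = n + (r - m) by rewrite [p + n]addrC addrAC addrK.
by rewrite /a mulrC [X in _ + X]mulrC.
Qed.

Theorem corollary3p1 (R : realType) (q : R[i]%C) (q_neq0 : q != 0%R)
    (hq : not_root_of_unity q)
    (mul : qVirasoro q_neq0 -> qVirasoro q_neq0 -> qVirasoro q_neq0)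
    (hmul : transposed_Poisson mul) :
  trivial_mul mul.
Proof.
case: hmul => [[mulPl mulPr] mulC _ mul_compat].
have two0 : (2 : R[i]%C) != 0 by rewrite pnatr_eq0.
have three0 : (3 : R[i]%C) != 0 by rewrite pnatr_eq0.
pose mulz z : {linear qVirasoro q_neq0 -> qVirasoro q_neq0} :=
  HB.pack (mul z) (GRing.isLinear.Build _ _ _ _ (mul z) (mulPr z)).
have mulZr z c x : mul z (c *: x) = c *: mul z x := linearZZ (mulz z) c x.
have mul_offdiag z (m r : int * int) :
    r != m -> qv_coef r (mul z (qvL _ m)) = 0.
  by apply: (half_derivation_offdiag (f := mulz z)) => // x y; exact: mul_compat.
have mulLL_neq (m n : int * int) : m != n -> mul (qvL _ m) (qvL _ n) = 0.
  move=> mn; apply: qv_coef_ext => r; have [->|] := eqVneq r n.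
    by rewrite mulC mul_offdiag // eq_sym.
  exact: mul_offdiag.
have mulLL (p n : int * int) : mul (qvL _ p) (qvL _ n) = 0.
  have [<-{n}|] := eqVneq p n; last exact: mulLL_neq.
  have [->|p0] := eqVneq p 0.
    apply: qv_coef_ext => r; have [->|] := eqVneq r 0; last exact: mul_offdiag.
    exact: qv_coef_at0.
  have [n np] := exists_noncollinear p0.
  have n0 : n != 0 by apply: contraNneq np => ->; exact: collinear0l.
  have pn : p != n by apply: contraNneq np => ->; exact: collinearxx.
  have pBn : p != p - n.
    by rewrite eq_sym -subr_eq0 addrC addKr oppr_eq0.
  (* [L_p] is proportional to the bracket of [L_(p - n)] and [L_n]. *)
  have := mul_compat (qvL _ (p - n)) (qvL _ n) (qvL _ p).
  rewrite lie_qvL subrK mulZr (mulLL_neq _ _ pBn) (mulLL_neq _ _ pn).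
  rewrite lie0l lie0r addr0 scalerA => /eqP.
  rewrite scaler_eq0 mulf_eq0 (negPf two0) (qv_lambda_eq0 q_neq0 hq) /=.
  rewrite collinearDl ?collinearNl ?collinearxx //.
  by rewrite collinearC (negPf np) => /eqP.
move=> x; apply: qv_linear_ext (mulPr x) _ => m.
move: x; apply: qv_linear_ext => [c x y|n]; first exact: mulPl.
exact: mulLL.
Qed.
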